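(* Let $I\subset\mathbb{R}$ be an interval, let $f:I\to(0,\infty)$, let $A,B$ be $n\times n$ complex Hermitian matrices with spectra in $I$, and let $0\le\alpha\le 1$. If $f$ is log-convex, then $$ \lambda^\downarrow\big(f(\alpha A+(1-\alpha)B)\big)\prec_{wlog}\lambda^\downarrow\big(f(A)^{\alpha}f(B)^{1-\alpha}\big). $$ If $f$ is log-concave, then $$ \lambda^\downarrow\big(f(\alpha A+(1-\alpha)B)\big)\prec^{wlog}\lambda^\downarrow\big(f(A)^{\alpha}f(B)^{1-\alpha}\big). $$
   Context: A positive function $f$ is log-convex (resp. log-concave) if $\log f$ is convex (resp. concave). For Hermitian $H$, $f(H)$ is defined by the spectral functional calculus. For a matrix $X$ with real eigenvalues (in particular for a product of two positive definite matrices, whose eigenvalues are positive), $\lambda^\downarrow(X)$ is the vector of eigenvalues of $X$, with multiplicity, in decreasing order. For vectors $x,y\in\mathbb{R}^n$ with positive coordinates, with decreasing and increasing rearrangements denoted by $\downarrow$ and $\uparrow$: the weak log-submajorization $x\prec_{wlog}y$ means $\prod_{j=1}^k x_j^\downarrow\le\prod_{j=1}^k y_j^\downarrow$ for all $1\le k\le n$; the weak log-supermajorization $x\prec^{wlog}y$ means $\prod_{j=1}^k x_j^\uparrow\ge\prod_{j=1}^k y_j^\uparrow$ for all $1\le k\le n$. *)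

(* Defs.v *)
From HB Require Import structures.
From mathcomp Require Import all_boot all_order all_algebra.
From mathcomp Require Import complex.
From mathcomp Require Import all_classical all_reals all_analysis.

Set Implicit Arguments.
Unset Strict Implicit.
Unset Printing Implicit Defensive.

Import Order.TTheory GRing.Theory Num.Theory.
Local Open Scope ring_scope.
Local Open Scope complex_scope.
Local Open Scope classical_set_scope.

(* A function f : J -> (0, oo) on an interval J is represented by a total
   function R -> R that is positive on J; its values outside J are irrelevant. *)
Definition log_convex (R : realType) (J : interval R) (f : R -> R) : Prop :=
  convex_function [set` J] (fun x : R^o => ln (f x) : R^o).

Definition log_concave (R : realType) (J : interval R) (f : R -> R) : Prop :=
  convex_function [set` J] (fun x : R^o => - ln (f x) : R^o).

(* Spectral functional calculus for a Hermitian H = U^-1 diag(d) U, where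
   U = spectralmx H is unitary and d = spectral_diag H is a row of complex
   numbers that are real because H is Hermitian. *)
Definition hfun (R : realType) (n : nat) (g : R -> R) (H : 'M[R[i]]_n) :
    'M[R[i]]_n :=
  invmx (spectralmx H)
    *m diag_mx (map_mx (fun z : R[i] => (g (complex.Re z))%:C) (spectral_diag H))
    *m spectralmx H.

(* Real power of a positive definite matrix. *)
Definition hpow (R : realType) (n : nat) (H : 'M[R[i]]_n) (a : R) :
    'M[R[i]]_n :=
  hfun (fun x => x `^ a) H.

Definition spectrum_in (R : realType) (n : nat) (J : interval R)
    (H : 'M[R[i]]_n) : Prop :=
  forall z : R[i], eigenvalue H z -> exists2 x : R, x \in J & z = x%:C.

Definition eigvals_seq (R : realType) (n : nat) (X : 'M[R[i]]_n) : seq R[i] :=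
  sval (closed_field_poly_normal (char_poly X)).

Lemma eigvals_seqE (R : realType) (n : nat) (X : 'M[R[i]]_n) :
  char_poly X = \prod_(z <- eigvals_seq X) ('X - z%:P).
Proof.
rewrite /eigvals_seq; case: closed_field_poly_normal => s /= {1}->.
by rewrite (monicP (char_poly_monic X)) scale1r.
Qed.

Lemma size_eigvals (R : realType) (n : nat) (X : 'M[R[i]]_n) :
  size (eigvals_seq X) == n.
Proof.
have := size_char_poly X; rewrite eigvals_seqE size_prod_XsubC.
by case=> ->.
Qed.

Definition eigvals (R : realType) (n : nat) (X : 'M[R[i]]_n) : n.-tuple R[i] :=
  Tuple (size_eigvals X).

(* Meant for matrices with real eigenvalues, on which [complex.Re] is just the
   identification of the real elements of R[i] with R. *)
Definition lambda_down (R : realType) (n : nat) (X : 'M[R[i]]_n) :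
    n.-tuple R :=
  [tuple of sort >=%R [tuple of map (@complex.Re R) (eigvals X)]].

Definition wlog_submaj (R : realType) (n : nat) (x y : n.-tuple R) : Prop :=
  forall k : nat, (1 <= k <= n)%N ->
    \prod_(j < k) (sort >=%R x)`_j <= \prod_(j < k) (sort >=%R y)`_j.

Definition wlog_supermaj (R : realType) (n : nat) (x y : n.-tuple R) : Prop :=
  forall k : nat, (1 <= k <= n)%N ->
    \prod_(j < k) (sort <=%R x)`_j >= \prod_(j < k) (sort <=%R y)`_j.

(* Main.v *)
(* Write f = e^g, C = alpha A + (1 - alpha) B, X = alpha g(A) and
   Y = (1 - alpha) g(B), so that f(A)^alpha f(B)^(1 - alpha) = e^X e^Y has the
   eigenvalues e^(z i) of the positive definite M = e^(Y/2) e^X e^(Y/2).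
   For unit eigenvectors u of C, Jensen's inequality gives
   g(<C u, u>) <= <(X + Y) u, u>.  For a real t, raising every eigenvalue of M
   to at least e^t gives M' >= M with M' >= e^t; as ln is operator monotone,
   K = ln (e^(-Y/2) M' e^(-Y/2)) satisfies K >= X and K + Y >= t, and
   tr (K + Y) = sum_i max(z i, t).  Hence for k orthonormal vectors u,
   sum <(X + Y) u, u> <= sum <(K + Y) u, u> <= sum_i max(z i, t) - (n - k) t,
   which for t the k-th largest z i is the sum of the k largest z i.  The
   log-concave case is the same argument applied to -g, -X, -Y and M^-1. *)

Require Import Defs.
From HB Require Import structures.
From mathcomp Require Import all_boot all_order all_algebra.
From mathcomp Require Import complex.
From mathcomp Require Import all_classical all_reals all_analysis.
From mathcomp Require Import perm ring lra.

Set Implicit Arguments.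
Unset Strict Implicit.
Unset Printing Implicit Defensive.

Import Order.TTheory GRing.Theory Num.Theory.
Local Open Scope ring_scope.
Local Open Scope complex_scope.
Local Open Scope sesquilinear_scope.

(** * Conjugation by unitary matrices *)

Section UnitaryConjugation.
Variables (C : numClosedFieldType) (n : nat).
Implicit Types U V D E H : 'M[C]_n.

Lemma adjmxM m p q (A : 'M[C]_(m, p)) (B : 'M[C]_(p, q)) :
  (A *m B)^t* = B^t* *m A^t*.
Proof. by rewrite trmx_mul map_mxM. Qed.

Lemma adjmx_hermsym H : H \is hermsymmx -> H^t* = H.
Proof. by move=> /is_hermitianmxP; rewrite expr0 scale1r. Qed.

Lemma hermsym_adjmx H : H^t* = H -> H \is hermsymmx.
Proof. by move=> HH; apply/is_hermitianmxP; rewrite expr0 scale1r HH. Qed.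

Lemma mulmx_unitary_adj U : U \is unitarymx -> U *m U^t* = 1%:M.
Proof. by move=> /unitarymxP. Qed.

Lemma mulmx_adj_unitary U : U \is unitarymx -> U^t* *m U = 1%:M.
Proof. by move=> /unitarymxP/mulmx1C. Qed.

Lemma uconjM U D E : U \is unitarymx ->
  (U^t* *m D *m U) *m (U^t* *m E *m U) = U^t* *m (D *m E) *m U.
Proof. by move=> Uu; rewrite !mulmxA (mulmxtVK _ Uu). Qed.

Lemma uconj_scalar U (c : C) : U \is unitarymx -> U^t* *m c%:M *m U = c%:M.
Proof.
by move=> Uu; rewrite mul_mx_scalar -scalemxAl mulmx_adj_unitary // scalemx1.
Qed.

Lemma eq_uconj_diag U (d e : 'rV[C]_n) : (forall i, d 0 i = e 0 i) ->
  U^t* *m diag_mx d *m U = U^t* *m diag_mx e *m U.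
Proof. by move=> de; congr (_ *m diag_mx _ *m _); apply/rowP. Qed.

Lemma det_uconj U D : U \is unitarymx -> \det (U^t* *m D *m U) = \det D.
Proof.
move=> Uu; rewrite !det_mulmx mulrC mulrA -det_mulmx.
by rewrite mulmx_unitary_adj // det1 mul1r.
Qed.

Lemma mxtrace_uconj U D : U \is unitarymx -> \tr (U^t* *m D *m U) = \tr D.
Proof.
by move=> Uu; rewrite mxtrace_mulC mulmxA mulmx_unitary_adj // mul1mx.
Qed.

(** With W the product of [U] and the adjoint of [V], comparing two diagonalisations amounts to D W
    = W E, which can be read entry by entry when [D] and [E] are diagonal. *)
Lemma uconj_intertwine U V D E : U \is unitarymx -> V \is unitarymx ->
  U^t* *m D *m U = V^t* *m E *m V <->
  D *m (U *m V^t*) = (U *m V^t*) *m E.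
Proof.
move=> Uu Vu; split=> [DE|DE].
  have /(congr1 (fun M => U *m M *m V^t*)) := DE; rewrite !mulmxA.
  by rewrite mulmx_unitary_adj // mul1mx (mulmxtVK _ Vu).
have /(congr1 (fun M => U^t* *m M *m V)) := DE.
rewrite -!mulmxA mulmx_adj_unitary // mulmx1 => ->.
by rewrite [LHS]mulmxA mulmx_adj_unitary // mul1mx.
Qed.

Lemma hermsym_uconj_spectral H : H \is hermsymmx ->
  H = (spectralmx H)^t* *m diag_mx (spectral_diag H) *m spectralmx H.
Proof.
move=> Hh; have /hermitian_normalmx /orthomx_spectralP := Hh.
by rewrite (invmx_unitary (spectral_unitarymx H)).
Qed.

Lemma invmx_spectralmx H : invmx (spectralmx H) = (spectralmx H)^t*.
Proof. exact/invmx_unitary/spectral_unitarymx. Qed.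

End UnitaryConjugation.

(** Eigenvalues are given as a real function, so that functional calculus becomes composition. For
    unitary [U] the rows of [U] are left eigenvectors. *)
Definition udiag (R : realType) n (U : 'M[R[i]]_n) (d : 'I_n -> R) :
    'M[R[i]]_n :=
  U^t* *m diag_mx (\row_i (d i)%:C) *m U.

(** Vectors are rows, to match the eigenvectors. For Hermitian [H] the value is already real, and
    [complex.Re] only moves it to [R]. *)
Definition qform (R : realType) n (H : 'M[R[i]]_n) (v : 'rV[R[i]]_n) : R :=
  complex.Re ((v *m H *m v^t*) 0 0).

(** For unitary [U] these are the masses of the spectral measure of [v] in the eigenbasis formed by
    the rows of [U]. *)
Definition weight (R : realType) n (U : 'M[R[i]]_n) (v : 'rV[R[i]]_n) i : R :=
  complex.Re (`|(v *m U^t*) 0 i| ^+ 2).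

(** * Functional calculus and quadratic forms of unitarily diagonalised matrices *)

Section UnitaryDiagonal.
Variable R : realType.
Implicit Types (n : nat).

Lemma ReMreal (a : R) (z : R[i]) : complex.Re (a%:C * z) = a * complex.Re z.
Proof. by case: z => x y /=; rewrite mul0r subr0. Qed.

Lemma conjC_real (x : R) : (x%:C)^*%R = x%:C :> R[i].
Proof. by rewrite conj_Creal // complex_real. Qed.

Lemma adjmx_diag n (d : 'I_n -> R) :
  (diag_mx (\row_i (d i)%:C))^t* = diag_mx (\row_i (d i)%:C) :> 'M[R[i]]_n.
Proof.
rewrite tr_diag_mx map_diag_mx; congr diag_mx.
by apply/rowP => i; rewrite !mxE; exact: conjC_real.
Qed.

Lemma adjmx_udiag n (U : 'M[R[i]]_n) d : (udiag U d)^t* = udiag U d.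
Proof. by rewrite /udiag !adjmxM trmxCK adjmx_diag mulmxA. Qed.

Lemma udiag_hermsym n (U : 'M[R[i]]_n) d : udiag U d \is hermsymmx.
Proof. exact/hermsym_adjmx/adjmx_udiag. Qed.

Lemma udiagM n (U : 'M[R[i]]_n) d e : U \is unitarymx ->
  udiag U d *m udiag U e = udiag U (fun i => d i * e i).
Proof.
move=> Uu; rewrite /udiag (uconjM _ _ Uu) mulmx_diag.
apply: eq_uconj_diag => i.
by rewrite !mxE rmorphM.
Qed.

Lemma udiag_cst n (U : 'M[R[i]]_n) (c : R) : U \is unitarymx ->
  udiag U (fun=> c) = (c%:C)%:M.
Proof.
move=> Uu; rewrite /udiag -[RHS](uconj_scalar _ Uu) -diag_const_mx.
by apply: eq_uconj_diag => i; rewrite !mxE.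
Qed.

Lemma det_udiag n (U : 'M[R[i]]_n) d : U \is unitarymx ->
  \det (udiag U d) = (\prod_i d i)%:C.
Proof.
move=> Uu; rewrite /udiag (det_uconj _ Uu) det_diag rmorph_prod.
by apply: eq_bigr => i _; rewrite mxE.
Qed.

Lemma mxtrace_udiag n (U : 'M[R[i]]_n) d : U \is unitarymx ->
  \tr (udiag U d) = (\sum_i d i)%:C.
Proof.
move=> Uu; rewrite /udiag (mxtrace_uconj _ Uu) mxtrace_diag rmorph_sum.
by apply: eq_bigr => i _; rewrite mxE.
Qed.

Lemma udiag_comp n (U V : 'M[R[i]]_n) d e (g : R -> R) :
  U \is unitarymx -> V \is unitarymx -> udiag U d = udiag V e ->
  udiag U (g \o d) = udiag V (g \o e).
Proof.
(* diag(d) W = W diag(e), W = U V^*, says that W i j = 0 unless d i = e j. *)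
move=> Uu Vu /(uconj_intertwine _ _ Uu Vu)/matrixP dW.
apply/(uconj_intertwine _ _ Uu Vu)/matrixP => i j.
have := dW i j; rewrite !mul_diag_mx !mul_mx_diag.
move: (U *m V^t*) => W; rewrite !mxE [RHS]mulrC => /eqP.
rewrite -subr_eq0 -mulrBl mulf_eq0 => /orP[|/eqP ->]; last first.
  by rewrite mulr0 mul0r.
by rewrite subr_eq0 => /eqP /complexI /= ->; rewrite mulrC.
Qed.

Lemma hfunE n (g : R -> R) (H : 'M[R[i]]_n) :
  hfun g H =
  udiag (spectralmx H) (fun i => g (complex.Re (spectral_diag H 0 i))).
Proof.
rewrite /hfun invmx_spectralmx /udiag.
by apply: eq_uconj_diag => i; rewrite !mxE.
Qed.

Lemma hermsym_spectral n (H : 'M[R[i]]_n) : H \is hermsymmx ->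
  H = udiag (spectralmx H) (fun i => complex.Re (spectral_diag H 0 i)).
Proof.
move=> Hh; rewrite [LHS](hermsym_uconj_spectral Hh) /udiag.
apply: eq_uconj_diag => i; rewrite !mxE.
by have /mxOverP/(_ 0 i)/RRe_real -> := hermitian_spectral_diag_real Hh.
Qed.

(** By [udiag_comp] the functional calculus does not depend on the diagonalisation, so it may be
    computed in any unitary eigenbasis instead of [spectralmx]. *)
Lemma hfun_udiag n (g : R -> R) (U : 'M[R[i]]_n) d : U \is unitarymx ->
  hfun g (udiag U d) = udiag U (g \o d).
Proof.
move=> Uu; rewrite hfunE; apply/esym.
exact: (udiag_comp g Uu (spectral_unitarymx _)
  (hermsym_spectral (udiag_hermsym U d))).
Qed.

Lemma qformD n (H K : 'M[R[i]]_n) v : qform (H + K) v = qform H v + qform K v.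
Proof. by rewrite /qform mulmxDr mulmxDl mxE raddfD. Qed.

Lemma qformZ n (a : R) (H : 'M[R[i]]_n) v : qform (a%:C *: H) v = a * qform H v.
Proof.
by rewrite /qform -scalemxAr -scalemxAl mxE; exact: ReMreal.
Qed.

Lemma qform_congr n (E H : 'M[R[i]]_n) v :
  qform (E *m H *m E^t*) v = qform H (v *m E).
Proof. by rewrite /qform adjmxM !mulmxA. Qed.

Lemma weight_ge0 n (U : 'M[R[i]]_n) v i : 0 <= weight U v i.
Proof.
rewrite /weight; have : 0 <= `|(v *m U^t*) 0 i| ^+ 2 by rewrite exprn_ge0.
by rewrite lecE => /andP[].
Qed.

Lemma qform_udiag n (U : 'M[R[i]]_n) d v :
  qform (udiag U d) v = \sum_i d i * weight U v i.
Proof.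
have -> : qform (udiag U d) v = qform (diag_mx (\row_i (d i)%:C)) (v *m U^t*).
  by rewrite -qform_congr trmxCK.
rewrite /qform mul_mx_diag mxE raddf_sum; apply: eq_bigr => i _.
rewrite /weight !mxE normCK -mulrA mulrCA.
exact: ReMreal.
Qed.

Lemma sum_weight n (U : 'M[R[i]]_n) v : U \is unitarymx ->
  \sum_i weight U v i = qform 1%:M v.
Proof.
move=> Uu; rewrite -[1%:M](udiag_cst 1 Uu) qform_udiag.
by apply: eq_bigr => i _; rewrite mul1r.
Qed.

End UnitaryDiagonal.

(** * Operator monotonicity of the square root and of the logarithm *)

Section LogMonotone.
Variable R : realType.
Implicit Types (n : nat).

Lemma rowM_udiag n (U : 'M[R[i]]_n) d i : U \is unitarymx ->
  row i U *m udiag U d = (d i)%:C *: row i U.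
Proof.
move=> Uu; rewrite -row_mul /udiag !mulmxA (mulmx_unitary_adj Uu) mul1mx.
by rewrite row_mul row_diag_mx mxE -scalemxAl -rowE.
Qed.

Lemma qform_mulmx_eigenl n (D H : 'M[R[i]]_n) (a : R) v :
  v *m D = a%:C *: v -> qform (D *m H) v = a * qform H v.
Proof.
by move=> vD; rewrite /qform mulmxA vD -!scalemxAl mxE; exact: ReMreal.
Qed.

Lemma qform_mulmx_eigenr n (D H : 'M[R[i]]_n) (a : R) v :
  D^t* = D -> v *m D = a%:C *: v -> qform (H *m D) v = a * qform H v.
Proof.
move=> DD vD; have Dv : D *m v^t* = a%:C *: v^t*.
  rewrite -[D in LHS]DD -adjmxM vD; apply/colP => j.
  by rewrite !mxE rmorphM /=; congr (_ * _); exact: conjC_real.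
by rewrite /qform -!mulmxA Dv -!scalemxAr mxE; exact: ReMreal.
Qed.

Lemma weight_gt0 n (U : 'M[R[i]]_n) v : U \is unitarymx -> v != 0 ->
  exists i, 0 < weight U v i.
Proof.
move=> Uu v0; have /rV0Pn[j vj] : v *m U^t* != 0.
  apply: contra_neq v0 => /(congr1 (mulmx^~ U)).
  by rewrite -mulmxA (mulmx_adj_unitary Uu) mulmx1 mul0mx.
exists j; rewrite /weight; have : 0 < `|(v *m U^t*) 0 j| ^+ 2.
  by rewrite exprn_gt0 // normr_gt0.
by rewrite ltcE => /andP[].
Qed.

Lemma qform_udiag_gt0 n (U : 'M[R[i]]_n) d v : U \is unitarymx ->
  (forall i, 0 < d i) -> v != 0 -> 0 < qform (udiag U d) v.
Proof.
move=> Uu d0 v0; have [i wi] := weight_gt0 Uu v0.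
rewrite qform_udiag (bigD1 i) //= ltr_pwDl ?mulr_gt0 // sumr_ge0 // => j _.
by rewrite mulr_ge0 ?weight_ge0 // ltW.
Qed.

Lemma row_unitary_neq0 n (U : 'M[R[i]]_n) i : U \is unitarymx -> row i U != 0.
Proof.
move=> Uu; apply/eqP => Ui; have /matrixP/(_ i i) := mulmx_unitary_adj Uu.
have -> : (U *m U^t*) i i = (row i U *m U^t*) 0 i by rewrite -row_mul [RHS]mxE.
rewrite Ui mul0mx mxE mxE eqxx => /eqP.
by rewrite eq_sym mulr1n oner_eq0.
Qed.

Lemma qform_udiag_le n (U : 'M[R[i]]_n) d e v : (forall i, d i <= e i) ->
  qform (udiag U d) v <= qform (udiag U e) v.
Proof.
move=> de; rewrite [leLHS]qform_udiag [leRHS]qform_udiag; apply: ler_sum => i _.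
exact: ler_wpM2r (weight_ge0 _ _ _) _ _ (de i).
Qed.

(** Expand the square as A^2 + A D + D (A + D): in both mixed terms [D] stands at an outer end,
    where it meets the eigenvector and becomes the scalar [a]. No commutation of [A] and [D] is
    involved. *)
Lemma qform_sqrD_eigen n (A D : 'M[R[i]]_n) (a : R) v :
  D^t* = D -> v *m D = a%:C *: v ->
  qform ((A + D) *m (A + D)) v =
  qform (A *m A) v + a * (qform A v + qform (A + D) v).
Proof.
move=> DD vD; rewrite mulmxDl [LHS]qformD (qform_mulmx_eigenl _ vD).
rewrite mulmxDr (qformD (A *m A)) (qform_mulmx_eigenr _ DD vD).
by rewrite -addrA -mulrDr.
Qed.

(* If (B - A) v = a v then <v, (B^2 - A^2) v> = a <v, (A + B) v>, so a >= 0. *)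
Lemma qform_sqrt_le n (U V : 'M[R[i]]_n) d e :
  U \is unitarymx -> V \is unitarymx ->
  (forall i, 0 < d i) -> (forall i, 0 < e i) ->
  (forall v, qform (udiag U (fun i => d i * d i)) v <=
             qform (udiag V (fun i => e i * e i)) v) ->
  forall v, qform (udiag U d) v <= qform (udiag V e) v.
Proof.
move=> Uu Vu d0 e0 le2 v.
pose A := udiag U d; pose B := udiag V e; pose D := B - A.
have Dh : D^t* = D.
  by rewrite /D linearB /= map_mxB !adjmx_udiag.
have DE := hermsym_spectral (hermsym_adjmx Dh).
set W := spectralmx D in DE; set m := (fun i => _) in DE.
have Wu : W \is unitarymx := spectral_unitarymx D.
have BE : B = A + D by rewrite /D addrC subrK.
have m0 i : 0 <= m i.
  have wD : row i W *m D = (m i)%:C *: row i W by rewrite DE rowM_udiag.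
  have := le2 (row i W); rewrite -(udiagM _ _ Uu) -(udiagM _ _ Vu) -/A -/B.
  rewrite {1 2}BE (qform_sqrD_eigen _ Dh wD) -BE lerDl => mle.
  rewrite -(@pmulr_lge0 _ (qform A (row i W) + qform B (row i W))) //.
  by rewrite addr_gt0 // qform_udiag_gt0 // row_unitary_neq0.
rewrite -/A -/B BE qformD lerDl DE qform_udiag sumr_ge0 // => i _.
by rewrite mulr_ge0 ?weight_ge0.
Qed.

(** From e^(-s) >= 1 - s one gets e^s (1 - s) <= 1, while (1 + s + 2 s^2)(1 - s) = 1 + s^2 (1 - 2 s)
    >= 1. *)
Lemma expR_le_quad (s : R) : s <= 2^-1 -> expR s <= 1 + s + 2 * s ^+ 2.
Proof.
move=> s2; have s1 : 0 < 1 - s by lra.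
have := expR_ge1Dx (- s).
rewrite expRN -(ler_pM2l (expR_gt0 s)) mulfV ?gt_eqF ?expR_gt0 // => h.
rewrite -(ler_pM2r s1); apply: le_trans h _.
have : 0 <= s ^+ 2 * (1 - 2 * s) by rewrite mulr_ge0 ?sqr_ge0 //; lra.
nra.
Qed.

Lemma exists_expn_ge (x : R) : exists m, x <= 2 ^+ m.
Proof.
exists (Num.truncn x).+1; apply: le_trans (ltW (truncnS_gt x)) _.
by rewrite -natrX ler_nat ltnW // ltn_expl.
Qed.

Lemma sum_affine (I : finType) (a b : R) (k w : I -> R) :
  \sum_i (1 + a * k i + b) * w i =
  \sum_i w i + a * (\sum_i k i * w i) + b * \sum_i w i.
Proof.
rewrite !mulr_sumr -!big_split; apply: eq_bigr => i _ /=; ring.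
Qed.

(** The logarithm is the limit of (e^(t h) - 1) / t for t = 2^-m. Repeated square roots give e^(t h)
    <= e^(t k) as forms; bounding the left side below by 1 + t h and the right side above by 1 + t k
    + 2 t^2 K^2, then dividing by t, leaves an error of order t. *)
Lemma qform_ln_le n (U V : 'M[R[i]]_n) h k :
  U \is unitarymx -> V \is unitarymx ->
  (forall v, qform (udiag U (expR \o h)) v <= qform (udiag V (expR \o k)) v) ->
  forall v, qform (udiag U h) v <= qform (udiag V k) v.
Proof.
move=> Uu Vu lehk v.
have root m : forall w, qform (udiag U (fun i => expR (h i / 2 ^+ m))) w <=
                        qform (udiag V (fun i => expR (k i / 2 ^+ m))) w.
  elim: m => [|m IHm] w.
    rewrite (_ : (fun i => expR (h i / _)) = expR \o h); last first.
      by apply: funext => i /=; rewrite expr0 divr1.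
    rewrite (_ : (fun i => expR (k i / _)) = expR \o k) //.
    by apply: funext => i /=; rewrite expr0 divr1.
  have half (f : 'I_n -> R) : (fun i => expR (f i / 2 ^+ m)) =
      (fun i => expR (f i / 2 ^+ m.+1) * expR (f i / 2 ^+ m.+1)).
    by apply: funext => i; rewrite -expRD exprSr invfM mulrA -splitr.
  apply: (qform_sqrt_le Uu Vu _ _ _ w) => [i|i|w'].
  - exact: expR_gt0.
  - exact: expR_gt0.
  - by rewrite -(half h) -(half k); exact: IHm.
pose N := qform 1%:M v; pose K : R := \sum_i `|k i|.
have N0 : 0 <= N.
  by rewrite /N -(sum_weight _ Uu) sumr_ge0 // => i _; exact: weight_ge0.
have K0 : 0 <= K by rewrite /K sumr_ge0.
have kK i : `|k i| <= K.
  by rewrite /K (bigD1 i) //= lerDl sumr_ge0.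
apply/ler_addgt0Pr => eps eps0.
(* The first summand forces t K <= 1/2, as [expR_le_quad] requires; the second makes the error 2 t
   K^2 N at most [eps]. *)
have [m m_ge] := exists_expn_ge (2 * K + 2 * K ^+ 2 * N / eps).
set t := (2 ^+ m)^-1 : R.
have t0 : 0 < t by rewrite invr_gt0 exprn_gt0.
have rest0 : 0 <= 2 * K ^+ 2 * N / eps.
  by rewrite divr_ge0 ?(ltW eps0) // mulr_ge0 // mulr_ge0 // sqr_ge0.
have m0 : 0 < 2 ^+ m :> R by rewrite exprn_gt0.
have tm : t * 2 ^+ m = 1 by rewrite mulVf // gt_eqF.
have tK : t * K <= 2^-1.
  have : t * (2 * K) <= t * 2 ^+ m by rewrite ler_pM2l //; lra.
  by rewrite tm; lra.
have teps : t * (2 * K ^+ 2 * N) <= eps.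
  have : t * (2 * K ^+ 2 * N / eps) <= t * 2 ^+ m by rewrite ler_pM2l //; lra.
  by rewrite tm mulrA ler_pdivrMr // mul1r.
have lo : N + t * qform (udiag U h) v <=
    qform (udiag U (fun i => expR (h i / 2 ^+ m))) v.
  rewrite /N -(sum_weight _ Uu) [leRHS]qform_udiag qform_udiag mulr_sumr.
  rewrite -big_split /=.
  apply: ler_sum => i _; rewrite mulrA -[X in X + _]mul1r -mulrDl.
  by rewrite ler_wpM2r ?weight_ge0 // mulrC expR_ge1Dx.
have hi : qform (udiag V (fun i => expR (k i / 2 ^+ m))) v <=
    N + t * qform (udiag V k) v + t * (t * (2 * K ^+ 2 * N)).
  have -> : N + t * qform (udiag V k) v + t * (t * (2 * K ^+ 2 * N)) =
     \sum_i (1 + t * k i + t ^+ 2 * (2 * K ^+ 2)) * weight V v i.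
    rewrite /N -(sum_weight _ Vu) !qform_udiag.
    by rewrite sum_affine; ring.
  rewrite qform_udiag; apply: ler_sum => i _.
  rewrite ler_wpM2r ?weight_ge0 // mulrC.
  have tk : `|t * k i| <= t * K.
    by rewrite normrM gtr0_norm // ler_pM2l.
  apply: le_trans (expR_le_quad _) _.
    by apply: le_trans tK; apply: le_trans tk; exact: ler_norm.
  rewrite lerD2l -[X in _ * X <= _]real_normK ?num_real //.
  rewrite (mulrCA (t ^+ 2)) ler_pM2l // -exprMn.
  by rewrite lerXn2r // nnegrE mulr_ge0 // ltW.
have := le_trans lo (le_trans (root m v) hi).
rewrite -(addrA N) lerD2l -mulrDr (ler_pM2l t0) => le_hk.
by apply: le_trans le_hk _; rewrite lerD2l.
Qed.

End LogMonotone.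

(** * Sandwiched products of exponentials and their trace inequality *)

Section Sandwich.
Variables (C : numClosedFieldType) (n : nat).
Implicit Types E F H M : 'M[C]_n.

Lemma adjmx_sandwich F H : F^t* = F -> H^t* = H ->
  (F *m H *m F)^t* = F *m H *m F.
Proof. by move=> FF HH; rewrite !adjmxM FF HH mulmxA. Qed.

Lemma sandwich_cancel E F H M : F *m E = 1%:M -> E *m H *m E = M ->
  H = F *m M *m F.
Proof.
move=> FE <-; have EF := mulmx1C FE.
by rewrite !mulmxA FE mul1mx -mulmxA EF mulmx1.
Qed.

End Sandwich.

Section ExpProduct.
Variable R : realType.
Implicit Types (n : nat).

Lemma sum_qform_row n (H T : 'M[R[i]]_n) : T \is unitarymx ->
  \sum_i qform H (row i T) = complex.Re (\tr H).
Proof.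
move=> Tu; have -> : \tr H = \tr (T *m H *m T^t*).
  by rewrite mxtrace_mulC mulmxA (mulmx_adj_unitary Tu) mul1mx.
rewrite /mxtrace raddf_sum; apply: eq_bigr => i _; congr complex.Re.
by rewrite -!row_mul !mxE; apply: eq_bigr => j _; rewrite !mxE.
Qed.

Lemma qform1_row n (T : 'M[R[i]]_n) i : T \is unitarymx ->
  qform 1%:M (row i T) = 1.
Proof.
move=> Tu; rewrite /qform mulmx1 (_ : _ 0 0 = (T *m T^t*) i i).
  by rewrite (mulmx_unitary_adj Tu) mxE eqxx.
by rewrite !mxE; apply: eq_bigr => j _; rewrite !mxE.
Qed.

(** Testing the form on the eigenvector [row i U] isolates [d i]. The positivity obtained here lets
    spectra be written as exponentials. *)
Lemma qform_gt0_udiag n (U : 'M[R[i]]_n) d : U \is unitarymx ->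
  (forall v, v != 0 -> 0 < qform (udiag U d) v) -> forall i, 0 < d i.
Proof.
move=> Uu pos i; have U0 := row_unitary_neq0 i Uu.
have := pos _ U0; rewrite -[udiag U d]mulmx1.
rewrite (qform_mulmx_eigenl _ (rowM_udiag d i Uu)) pmulr_lgt0 //.
by rewrite -[1%:M](udiag_cst 1 Uu) qform_udiag_gt0.
Qed.

(* Operator monotonicity of ln gives K := ln (e^(-Y/2) M' e^(-Y/2)) >= X and
   K >= t - Y, where M' := W^* e^(max(z,t)) W; below K = udiag W' k. *)
Lemma sum_qform_exp_product n (U V W T : 'M[R[i]]_n) (x y z : 'I_n -> R)
    (S : {set 'I_n}) (t : R) :
  U \is unitarymx -> V \is unitarymx -> W \is unitarymx -> T \is unitarymx ->
  udiag V (fun i => expR (y i / 2)) *m udiag U (expR \o x)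
    *m udiag V (fun i => expR (y i / 2)) = udiag W (expR \o z) ->
  \sum_(i in S) (qform (udiag U x) (row i T) + qform (udiag V y) (row i T))
    <= #|S|%:R * t + \sum_i (Num.max (z i) t - t).
Proof.
move=> Uu Vu Wu Tu EPE.
set E := udiag V _ in EPE; pose F := udiag V (fun i => expR (- (y i / 2))).
pose m i := Num.max (z i) t; pose M' := udiag W (expR \o m).
have inv_y (f : 'I_n -> R) : (forall i, f i = 1) -> udiag V f = 1%:M.
  by move=> f1; rewrite (_ : f = fun=> 1) ?(udiag_cst 1 Vu) //; exact: funext.
have FE : F *m E = 1%:M.
  by rewrite (udiagM _ _ Vu); apply: inv_y => i; rewrite -expRD addNr expR0.
have EF : E *m F = 1%:M by exact: mulmx1C.
have Fh : F^t* = F := adjmx_udiag _ _.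
pose P' := F *m M' *m F.
have P'E v : qform P' v = qform M' (v *m F).
  by rewrite -qform_congr Fh.
have P'h : P'^t* = P' by exact: adjmx_sandwich Fh (adjmx_udiag _ _).
have := hermsym_spectral (hermsym_adjmx P'h).
set W' := spectralmx P'; set d := (fun i => _) => P'd.
have W'u : W' \is unitarymx := spectral_unitarymx P'.
(* [P'] is a congruence of the positive definite [M'] by the invertible [F]. *)
have d0 i : 0 < d i.
  apply: (qform_gt0_udiag W'u) => v v0; rewrite -P'd P'E.
  apply: (qform_udiag_gt0 Wu) => [j|]; first exact: expR_gt0.
  apply: contra_neq v0 => /(congr1 (mulmx^~ E)).
  by rewrite -mulmxA FE mulmx1 mul0mx.
pose k i := ln (d i).
have dk : d = expR \o k by apply: funext => i /=; rewrite lnK ?posrE.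
rewrite dk in P'd.
(* Solving [EPE] for e^X shows that it is the congruence by [F] of the matrix with exponents [z],
   which [M'] dominates. *)
have leX : forall v, qform (udiag U x) v <= qform (udiag W' k) v.
  apply: (qform_ln_le Uu W'u) => v; rewrite -P'd P'E.
  have -> : udiag U (expR \o x) = F *m udiag W (expR \o z) *m F^t*.
    by rewrite Fh; exact: sandwich_cancel FE EPE.
  rewrite qform_congr; apply: qform_udiag_le => i /=.
  by rewrite ler_expR le_max lexx.
(* Since M' >= e^t, its congruence by [F] dominates e^t F^2 = e^(t - Y). *)
have leY : forall v,
    qform (udiag V (fun i => t - y i)) v <= qform (udiag W' k) v.
  apply: (qform_ln_le Vu W'u) => v; rewrite -P'd P'E.
  have -> : udiag V (expR \o (fun i => t - y i)) =
      F *m udiag W (fun=> expR t) *m F^t*.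
    rewrite Fh (udiag_cst _ Wu) -(udiag_cst _ Vu) !(udiagM _ _ Vu).
    congr udiag; apply: funext => i /=.
    by rewrite -!expRD; congr expR; field.
  rewrite qform_congr; apply: qform_udiag_le => i /=.
  by rewrite ler_expR le_max lexx orbT.
(* Determinants are multiplicative even though the factors do not commute, and each of the two
   factors [F] contributes half of the sum of [y]. *)
have trK : \sum_i k i + \sum_i y i = \sum_i m i.
  have := congr1 determinant P'd.
  rewrite /P' (det_mulmx (F *m M') F) (det_mulmx F M').
  rewrite (det_udiag _ Vu) (det_udiag _ Wu).
  rewrite (det_udiag _ W'u) -!rmorphM => /complexI /=.
  rewrite -!expR_sum -!expRD => /expR_inj <-.
  by rewrite sumrN -mulr_suml; field.
pose q i := qform (udiag W' k) (row i T) + qform (udiag V y) (row i T).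
have q_sum : \sum_i q i = \sum_i m i.
  rewrite big_split /= !sum_qform_row // -trK.
  by rewrite (mxtrace_udiag _ W'u) (mxtrace_udiag _ Vu).
have q_ge i : t <= q i.
  have := leY (row i T).
  have -> : qform (udiag V (fun j => t - y j)) (row i T) =
      t * qform 1%:M (row i T) - qform (udiag V y) (row i T).
    rewrite -(sum_weight _ Vu) [LHS]qform_udiag [in X in _ - X]qform_udiag.
    by rewrite mulr_sumr -sumrB; apply: eq_bigr => j _; rewrite mulrBl.
  by rewrite qform1_row // mulr1 lerBlDr.
apply: (@le_trans _ _ (\sum_(i in S) q i)).
  by apply: ler_sum => i _; rewrite lerD2r.
(* By [q_ge] every index outside [S] retains at least [t] of the total trace. *)
have : \sum_(i in S) q i + \sum_(i | i \notin S) t <= \sum_i m i.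
  by rewrite -q_sum [leRHS](bigID (mem S)) /= lerD2l; apply: ler_sum.
rewrite sumrB [in X in _ <= _ + (_ - X)](bigID (mem S)) /=.
rewrite mulr_natl -sumr_const.
by rewrite opprD addrCA addNKr -lerBrDr.
Qed.

End ExpProduct.

(** * Characteristic polynomials and sorted eigenvalues *)

Section CharPoly.

Lemma char_poly_sandwich (K : comNzRingType) n (E H F : 'M[K]_n) :
  F *m E = 1%:M -> char_poly (E *m H *m F) = char_poly H.
Proof.
move=> FE; have EF := mulmx1C FE; rewrite /char_poly.
have -> : char_poly_mx (E *m H *m F) =
    map_mx polyC E *m char_poly_mx H *m map_mx polyC F.
  rewrite /char_poly_mx mulmxBr mulmxBl -!map_mxM; congr (_ - _).
  by rewrite mul_mx_scalar -scalemxAl -map_mxM EF map_mx1 scalemx1.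
rewrite !det_mulmx mulrC mulrA -det_mulmx -map_mxM FE.
by rewrite map_mx1 det1 mul1r.
Qed.

Variable R : realType.
Implicit Types (n : nat).

Lemma char_poly_udiag n (U : 'M[R[i]]_n) d : U \is unitarymx ->
  char_poly (udiag U d) = \prod_i ('X - (d i)%:C%:P).
Proof.
move=> Uu; rewrite (char_poly_sandwich _ (mulmx_unitary_adj Uu)).
rewrite char_poly_trig ?diag_mx_is_trig //; apply: eq_bigr => i _.
by rewrite !mxE eqxx mulr1n.
Qed.

(** Factorisation into monic linear factors is unique up to order, and sorting only permutes. The
    relation [r] is arbitrary so that decreasing and increasing orders are both covered. *)
Lemma sort_lambda_down n (X : 'M[R[i]]_n) (d : 'I_n -> R) (r : rel R) :
  char_poly X = \prod_i ('X - (d i)%:C%:P) ->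
  exists p : 'S_n, forall j : 'I_n, (sort r (lambda_down X))`_j = d (p j).
Proof.
move=> Xd; pose t := [tuple d i | i < n].
have /tuple_permP[p sE] : perm_eq (sort r (lambda_down X)) t.
  rewrite perm_sort /= perm_sort.
  have /prod_XsubC_eq /(perm_map (@complex.Re R)) :
      \prod_(z <- eigvals_seq X) ('X - z%:P) =
      \prod_(z <- [seq (d i)%:C | i <- enum 'I_n]) ('X - z%:P).
    by rewrite -eigvals_seqE Xd big_map big_enum.
  by rewrite -map_comp.
exists p => j; rewrite sE (nth_map j) ?size_enum_ord // nth_ord_enum.
by rewrite tnth_mktuple.
Qed.

End CharPoly.

(** * From threshold bounds to sums of the largest entries *)

Section TopSums.
Variable R : realType.

(** At the threshold t equal to the k-th largest [z], the terms max(z, t) - t vanish beyond the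
    first k, and the k copies of t restore the others to [z]. *)
Lemma sum_top_le n (a z : 'I_n -> R) (p q : 'S_n) k :
  (forall (S : {set 'I_n}) t, \sum_(i in S) a i <=
     #|S|%:R * t + \sum_i (Num.max (z i) t - t)) ->
  (forall i j : 'I_n, (i <= j)%N -> z (q j) <= z (q i)) ->
  (1 <= k <= n)%N ->
  \sum_(i < n | (i < k)%N) a (p i) <= \sum_(i < n | (i < k)%N) z (q i).
Proof.
move=> majS zq /andP[k1 kn].
have k1n : (k.-1 < n)%N by rewrite prednK.
(* Positions start at 0, so the k-th largest value sits at [k.-1]. *)
pose t := z (q (Ordinal k1n)).
have := majS (p @: [set i : 'I_n | (i < k)%N]) t.
rewrite big_imset /=; last by move=> i j _ _; exact: perm_inj.
rewrite card_imset; last exact: perm_inj.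
rewrite (eq_bigl (fun i : 'I_n => (i < k)%N)); last by move=> i; rewrite inE.
move=> /le_trans; apply; rewrite (reindex_inj (@perm_inj _ q)) /=.
rewrite (bigID (fun i : 'I_n => (i < k)%N)) /=.
rewrite [X in _ + (_ + X)]big1; last first.
  move=> i; rewrite -leqNgt => ki; rewrite max_r ?subrr // zq //=.
  by rewrite (leq_trans (leq_pred k)).
have -> : #|[set i : 'I_n | (i < k)%N]|%:R * t = \sum_(i < n | (i < k)%N) t.
  by rewrite mulr_natl -sumr_const; apply: eq_bigl => i; rewrite inE.
rewrite addr0 -big_split /=; apply: ler_sum => i ik.
rewrite max_l; first by rewrite addrC subrK.
by rewrite zq //= -ltnS prednK.
Qed.

End TopSums.

(** * Jensen's inequality for finite weighted sums *)

Section Jensen.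
Variables (R : realType) (J : interval R) (g : R -> R).
Hypothesis g_cvx : convex_function [set` J] (g : R^o -> R^o).

Lemma convex_combination (t x y : R) : 0 <= t <= 1 -> x \in J -> y \in J ->
  t * x + (1 - t) * y \in J /\
  g (t * x + (1 - t) * y) <= t * g x + (1 - t) * g y.
Proof.
move=> /andP[t0 t1] xJ yJ; split; last first.
  have := g_cvx (Itv01 t0 t1); apply; by rewrite inE.
have JJ := @interval_is_interval _ J.
have mid (s u v : R) : 0 <= s <= 1 -> u <= v -> u \in J -> v \in J ->
    s * u + (1 - s) * v \in J.
  move=> /andP[s0 s1] uv uJ vJ; apply: (JJ u v) => //.
  by apply/andP; split; nra.
have [xy|yx] := leP x y; first by apply: mid => //; rewrite t0.
rewrite (_ : t * x + _ = (1 - t) * y + (1 - (1 - t)) * x); last by ring.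
by apply: mid => //; [rewrite subr_ge0 t1 gerBl | exact: ltW].
Qed.

Lemma jensen_sum (I : finType) (w a : I -> R) :
  (forall i, 0 <= w i) -> \sum_i w i = 1 -> (forall i, a i \in J) ->
  \sum_i a i * w i \in J /\ g (\sum_i a i * w i) <= \sum_i g (a i) * w i.
Proof.
move=> w0 w1 aJ.
have mulC (f : I -> R) : \sum_i f i * w i = \sum_i w i * f i.
  by apply: eq_bigr => i _; rewrite mulrC.
rewrite (mulC a) (mulC (fun i => g (a i))).
have [i0 _|no] := pickP (@predT I); last first.
  by move: w1; rewrite big_pred0 // => /eqP; rewrite eq_sym oner_eq0.
(* For the induction the partial weights need not sum to 1: [c] is a barycentre in [J], and the
   relations are multiplied by the total weight to avoid division. If that weight is 0, any point of
   [J] serves, such as [a i0] for the empty list. *)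
suff [c [cJ cE cg]] : exists c, [/\ c \in J,
    \sum_(i <- enum I) w i * a i = (\sum_(i <- enum I) w i) * c &
    (\sum_(i <- enum I) w i) * g c <= \sum_(i <- enum I) w i * g (a i)].
  by move: cE cg; rewrite !big_enum /= w1 !mul1r => -> cg.
elim: (enum I) => [|i r [c [cJ cE cg]]].
  by exists (a i0); rewrite !big_nil !mul0r.
rewrite !big_cons; set W := \sum_(j <- r) w j in cE cg *.
have W0 : 0 <= W by apply: sumr_ge0.
have [W'0|W'0] := eqVneq (w i + W) 0.
  have /andP[/eqP wi0 _] : (w i == 0) && (W == 0).
    by rewrite -paddr_eq0 // W'0.
  by exists c; split=> //; rewrite ?cE wi0 mul0r !add0r.
have W'gt0 : 0 < w i + W by rewrite lt_def W'0 addr_ge0.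
pose t := w i / (w i + W).
have t01 : 0 <= t <= 1.
  by rewrite divr_ge0 ?(ltW W'gt0) // ler_pdivrMr // mul1r lerDl.
have tW : (w i + W) * t = w i by rewrite mulrC divfK.
have t'W : (w i + W) * (1 - t) = W by rewrite mulrBr mulr1 tW addrC addKr.
have [c'J c'g] := convex_combination t01 (aJ i) cJ.
exists (t * a i + (1 - t) * c); split=> //.
  by rewrite mulrDr (mulrA _ t) tW (mulrA _ (1 - t)) t'W cE.
apply: (@le_trans _ _ ((w i + W) * (t * g (a i) + (1 - t) * g c))).
  by rewrite ler_pM2l.
by rewrite mulrDr (mulrA _ t) tW (mulrA _ (1 - t)) t'W lerD2l.
Qed.

End Jensen.

(** * Spectra of exponential products, and Jensen's inequality for matrices *)

Lemma sandwich_inv (K : comNzRingType) n (E F P Q M N : 'M[K]_n) :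
  F *m E = 1%:M -> Q *m P = 1%:M -> N *m M = 1%:M ->
  E *m P *m E = M -> F *m Q *m F = N.
Proof.
move=> FE QP NM EPE; have MN := mulmx1C NM.
rewrite -[LHS]mulmx1 -MN -EPE !mulmxA -(mulmxA _ F E) FE mulmx1.
by rewrite -(mulmxA _ Q P) QP mulmx1 FE mul1mx.
Qed.

(** Conjugating P E^2 by the invertible [E] gives E P E. *)
Lemma char_poly_mul_square (K : comNzRingType) n (E F P : 'M[K]_n) :
  F *m E = 1%:M -> char_poly (P *m (E *m E)) = char_poly (E *m P *m E).
Proof.
move=> FE; rewrite -(char_poly_sandwich _ FE) !mulmxA.
by rewrite -(mulmxA _ E F) (mulmx1C FE) mulmx1.
Qed.

Section SpectralJensen.
Variable R : realType.
Implicit Types (n : nat) (J : interval R).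

Lemma spectrum_in_spectral_diag n J (A : 'M[R[i]]_n) i :
  A \is hermsymmx -> spectrum_in J A -> complex.Re (spectral_diag A 0 i) \in J.
Proof.
move=> Ah AJ; have Uu := spectral_unitarymx A.
have Ai : eigenvalue A (complex.Re (spectral_diag A 0 i))%:C.
  apply/eigenvalueP; exists (row i (spectralmx A)).
    by rewrite {2}(hermsym_spectral Ah) (rowM_udiag _ _ Uu).
  exact: row_unitary_neq0.
by have [x xJ /complexI ->] := AJ _ Ai.
Qed.

Lemma qform_udiag_row n (T : 'M[R[i]]_n) c i : T \is unitarymx ->
  qform (udiag T c) (row i T) = c i.
Proof.
move=> Tu; rewrite -[udiag T c]mulmx1.
by rewrite (qform_mulmx_eigenl _ (rowM_udiag c i Tu)) qform1_row // mulr1.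
Qed.

(** Row [i] of [T] is a unit eigenvector of the combination, so [c i] is the same combination of the
    forms of the two matrices. Each form averages eigenvalues with weights of sum 1: apply Jensen to
    each, after convexity of [g] at the two averages. *)
Lemma qform_jensen n J (g : R -> R) (U V T : 'M[R[i]]_n) a b c (alpha : R) :
  convex_function [set` J] (g : R^o -> R^o) ->
  U \is unitarymx -> V \is unitarymx -> T \is unitarymx ->
  (forall i, a i \in J) -> (forall i, b i \in J) -> 0 <= alpha <= 1 ->
  alpha%:C *: udiag U a + (1 - alpha)%:C *: udiag V b = udiag T c ->
  forall i, c i \in J /\
    g (c i) <= qform (udiag U (fun j => alpha * g (a j))) (row i T)
             + qform (udiag V (fun j => (1 - alpha) * g (b j))) (row i T).
Proof.
move=> g_cvx Uu Vu Tu aJ bJ alpha01 Tc i.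
have jen (Z : 'M[R[i]]_n) d : Z \is unitarymx -> (forall j, d j \in J) ->
    qform (udiag Z d) (row i T) \in J /\
    g (qform (udiag Z d) (row i T)) <= qform (udiag Z (g \o d)) (row i T).
  move=> Zu dJ; have w1 : \sum_j weight Z (row i T) j = 1.
    by rewrite (sum_weight _ Zu) qform1_row.
  have [sJ sg] := jensen_sum g_cvx (weight_ge0 Z (row i T)) w1 dJ.
  split; first by rewrite qform_udiag.
  by rewrite [leRHS]qform_udiag qform_udiag.
have scale (Z : 'M[R[i]]_n) d s :
    qform (udiag Z (fun j => s * g (d j))) (row i T) =
    s * qform (udiag Z (g \o d)) (row i T).
  rewrite [LHS]qform_udiag [in RHS]qform_udiag mulr_sumr.
  by apply: eq_bigr => j _; rewrite mulrA.
have [qaJ ga] := jen U a Uu aJ; have [qbJ gb] := jen V b Vu bJ.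
have <- : alpha * qform (udiag U a) (row i T)
        + (1 - alpha) * qform (udiag V b) (row i T) = c i.
  by rewrite -!qformZ -qformD Tc qform_udiag_row.
have [cJ gc] := convex_combination g_cvx alpha01 qaJ qbJ; split=> //.
have /andP[al0 al1] := alpha01.
apply: (le_trans gc); apply: lerD; rewrite [leRHS]scale.
  exact: ler_wpM2l ga.
by apply: ler_wpM2l gb; rewrite subr_ge0.
Qed.

Lemma exp_product_spectral n (U V : 'M[R[i]]_n) x y :
  U \is unitarymx -> V \is unitarymx ->
  exists W z, W \is unitarymx /\
    udiag V (fun i => expR (y i / 2)) *m udiag U (expR \o x)
      *m udiag V (fun i => expR (y i / 2)) = udiag W (expR \o z).
Proof.
move=> Uu Vu; set E := udiag V _; set M := _ *m _ *m E.
have Eh : E^t* = E := adjmx_udiag _ _.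
have Mh : M^t* = M by exact: adjmx_sandwich Eh (adjmx_udiag _ _).
have := hermsym_spectral (hermsym_adjmx Mh).
set W := spectralmx M; set d := (fun i => _) => Md.
have Wu : W \is unitarymx := spectral_unitarymx M.
have d0 i : 0 < d i.
  apply: (qform_gt0_udiag Wu) => v v0; rewrite -Md.
  have -> : qform M v = qform (udiag U (expR \o x)) (v *m E).
    by rewrite -qform_congr Eh.
  apply: (qform_udiag_gt0 Uu) => [j|]; first exact: expR_gt0.
  apply: contra_neq v0 => vE.
  pose F := udiag V (fun i => expR (- (y i / 2))).
  have EF : E *m F = 1%:M.
    rewrite (udiagM _ _ Vu) -(udiag_cst 1 Vu); congr udiag.
    by apply: funext => j; rewrite -expRD subrr expR0.
  by rewrite -[v]mulmx1 -EF mulmxA vE mul0mx.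
exists W, (fun i => ln (d i)); split; first exact: Wu.
rewrite Md; congr udiag.
by apply: funext => i /=; rewrite lnK ?posrE.
Qed.

(** Invert both sides: every exponent changes sign while the eigenbases stay the same. This carries
    the log-concave case back to convexity of -ln f. *)
Lemma exp_product_spectral_inv n (U V W : 'M[R[i]]_n) x y z :
  U \is unitarymx -> V \is unitarymx -> W \is unitarymx ->
  udiag V (fun i => expR (y i / 2)) *m udiag U (expR \o x)
    *m udiag V (fun i => expR (y i / 2)) = udiag W (expR \o z) ->
  udiag V (fun i => expR (- y i / 2)) *m udiag U (expR \o (fun i => - x i))
    *m udiag V (fun i => expR (- y i / 2)) = udiag W (expR \o (fun i => - z i)).
Proof.
move=> Uu Vu Wu EPE.
have inv (Z : 'M[R[i]]_n) (d e : 'I_n -> R) : Z \is unitarymx ->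
    (forall i, d i = - e i) ->
    udiag Z (expR \o d) *m udiag Z (expR \o e) = 1%:M.
  move=> Zu de; rewrite (udiagM _ _ Zu) -(udiag_cst 1 Zu); congr udiag.
  by apply: funext => i /=; rewrite -expRD de addNr expR0.
apply: sandwich_inv EPE.
- by apply: inv => // i; rewrite mulNr.
- by apply: inv.
- by apply: inv.
Qed.

Lemma char_poly_exp_product n (U V W : 'M[R[i]]_n) x y z :
  V \is unitarymx -> W \is unitarymx ->
  udiag V (fun i => expR (y i / 2)) *m udiag U (expR \o x)
    *m udiag V (fun i => expR (y i / 2)) = udiag W (expR \o z) ->
  char_poly (udiag U (expR \o x) *m udiag V (expR \o y)) =
  \prod_i ('X - (expR (z i))%:C%:P).
Proof.
move=> Vu Wu EPE; rewrite -(char_poly_udiag _ Wu) -EPE.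
set E := udiag V (fun i => _) in EPE *.
pose F := udiag V (fun i => expR (- (y i / 2))).
have FE : F *m E = 1%:M.
  rewrite (udiagM _ _ Vu) -(udiag_cst 1 Vu); congr udiag.
  by apply: funext => j; rewrite -expRD addNr expR0.
have -> : udiag V (expR \o y) = E *m E.
  rewrite (udiagM _ _ Vu); congr udiag; apply: funext => i /=.
  by rewrite -expRD -splitr.
exact: char_poly_mul_square FE.
Qed.

End SpectralJensen.

Lemma adjmx_real_comb (R : realType) n (A B : 'M[R[i]]_n) (s t : R) :
  A^t* = A -> B^t* = B -> (s%:C *: A + t%:C *: B)^t* = s%:C *: A + t%:C *: B.
Proof.
move=> AA BB; rewrite -{2}AA -{2}BB; apply/matrixP => i j.
by rewrite !mxE rmorphD !rmorphM /=; congr (_ * _ + _ * _); exact: conjC_real.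
Qed.

(** * Assembling the logarithmic majorizations *)

Section LogMajorization.
Variable R : realType.
Implicit Types (n : nat) (J : interval R).

Lemma hpow_hfun n (f : R -> R) (H : 'M[R[i]]_n) s :
  (forall i, 0 < f (complex.Re (spectral_diag H 0 i))) ->
  hpow (hfun f H) s = udiag (spectralmx H)
    (expR \o (fun i => s * ln (f (complex.Re (spectral_diag H 0 i))))).
Proof.
move=> f0; rewrite hfunE /hpow (hfun_udiag _ _ (spectral_unitarymx H)).
congr udiag; apply: funext => i /=.
(* [powR] is exp(s ln x) away from the special case x = 0, which positivity excludes. *)
by rewrite /powR gt_eqF.
Qed.

(** The exponents are prescribed only pointwise, so that the lemma also accepts the negated ones
    with g = -ln f. *)
Lemma sum_le_convex_exp_product n J (g : R -> R) (U V T W : 'M[R[i]]_n)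
    a b c x y z (alpha : R) :
  convex_function [set` J] (g : R^o -> R^o) ->
  U \is unitarymx -> V \is unitarymx -> T \is unitarymx -> W \is unitarymx ->
  (forall i, a i \in J) -> (forall i, b i \in J) -> 0 <= alpha <= 1 ->
  alpha%:C *: udiag U a + (1 - alpha)%:C *: udiag V b = udiag T c ->
  x =1 (fun i => alpha * g (a i)) -> y =1 (fun i => (1 - alpha) * g (b i)) ->
  udiag V (fun i => expR (y i / 2)) *m udiag U (expR \o x)
    *m udiag V (fun i => expR (y i / 2)) = udiag W (expR \o z) ->
  forall (S : {set 'I_n}) t, \sum_(i in S) g (c i) <=
     #|S|%:R * t + \sum_i (Num.max (z i) t - t).
Proof.
move=> g_cvx Uu Vu Tu Wu aJ bJ alpha01 Tc /funext xE /funext yE EPE S t.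
apply: le_trans (sum_qform_exp_product S t Uu Vu Wu Tu EPE).
apply: ler_sum => i _; rewrite xE yE.
by have [] := qform_jensen g_cvx Uu Vu Tu aJ bJ alpha01 Tc i.
Qed.

Lemma prod_nth_expR_le n k (s t : seq R) (d e : 'I_n -> R) : (k <= n)%N ->
  (forall i : 'I_n, s`_i = expR (d i)) ->
  (forall i : 'I_n, t`_i = expR (e i)) ->
  \sum_(i < n | (i < k)%N) d i <= \sum_(i < n | (i < k)%N) e i ->
  \prod_(j < k) s`_j <= \prod_(j < k) t`_j.
Proof.
move=> kn sd te le_de.
rewrite (big_ord_widen _ (fun j => s`_j) kn).
rewrite (big_ord_widen _ (fun j => t`_j) kn).
rewrite (eq_bigr _ (fun i _ => sd i)) (eq_bigr _ (fun i _ => te i)).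
by rewrite -!expR_sum ler_expR.
Qed.

Lemma sort_nth_le (leR : rel R) (s : seq R) i j :
  total leR -> transitive leR -> (i <= j < size s)%N ->
  leR (sort leR s)`_i (sort leR s)`_j.
Proof.
move=> le_total le_tr /andP[ij js].
apply: (sorted_leq_nth le_tr) => //; rewrite ?inE ?size_sort //.
- by move=> x; have := le_total x x; rewrite orbb.
- exact: sort_sorted.
- exact: leq_ltn_trans js.
Qed.

End LogMajorization.

Theorem theorem3p3 (R : realType) (J : interval R) (f : R -> R)
    (f_gt0 : forall x : R, x \in J -> 0 < f x)
    (n : nat) (A B : 'M[R[i]]_n)
    (A_herm : A \is hermsymmx) (B_herm : B \is hermsymmx)
    (A_spec : spectrum_in J A) (B_spec : spectrum_in J B)
    (alpha : R) (alpha01 : 0 <= alpha <= 1) :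
  (log_convex J f ->
     wlog_submaj
       (lambda_down (hfun f (alpha%:C *: A + (1 - alpha)%:C *: B)))
       (lambda_down (hpow (hfun f A) alpha *m hpow (hfun f B) (1 - alpha))))
  /\
  (log_concave J f ->
     wlog_supermaj
       (lambda_down (hfun f (alpha%:C *: A + (1 - alpha)%:C *: B)))
       (lambda_down (hpow (hfun f A) alpha *m hpow (hfun f B) (1 - alpha)))).
Proof.
set C := _ + _ *: B.
have Ch : C \is hermsymmx.
  apply: hermsym_adjmx.
  exact: adjmx_real_comb (adjmx_hermsym A_herm) (adjmx_hermsym B_herm).
pose U := spectralmx A; pose V := spectralmx B; pose T := spectralmx C.
have Uu : U \is unitarymx := spectral_unitarymx A.
have Vu : V \is unitarymx := spectral_unitarymx B.
have Tu : T \is unitarymx := spectral_unitarymx C.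
pose a i := complex.Re (spectral_diag A 0 i).
pose b i := complex.Re (spectral_diag B 0 i).
pose c i := complex.Re (spectral_diag C 0 i).
have aJ i : a i \in J := spectrum_in_spectral_diag i A_herm A_spec.
have bJ i : b i \in J := spectrum_in_spectral_diag i B_herm B_spec.
have Tc : alpha%:C *: udiag U a + (1 - alpha)%:C *: udiag V b = udiag T c.
  by rewrite -(hermsym_spectral A_herm) -(hermsym_spectral B_herm)
     -(hermsym_spectral Ch).
pose x i := alpha * ln (f (a i)); pose y i := (1 - alpha) * ln (f (b i)).
have powA : hpow (hfun f A) alpha = udiag U (expR \o x).
  by apply: hpow_hfun => i; exact: f_gt0 (aJ i).
have powB : hpow (hfun f B) (1 - alpha) = udiag V (expR \o y).
  by apply: hpow_hfun => i; exact: f_gt0 (bJ i).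
have [W [z [Wu EPE]]] := exp_product_spectral x y Uu Vu.
have PQ := char_poly_exp_product Vu Wu EPE; rewrite -powA -powB in PQ.
have fC : char_poly (hfun f C) = \prod_i ('X - (f (c i))%:C%:P).
  by rewrite hfunE; exact: char_poly_udiag Tu.
have lnf0 i : c i \in J -> f (c i) = expR (ln (f (c i))).
  by move=> /f_gt0 fc; rewrite lnK ?posrE.
split=> [f_cvx|f_ccv] k k1n; have /andP[_ kn] := k1n.
(* [f] is known to be positive only on [J], so the eigenvalues of [C] are located there before
   logarithms are taken. *)
- have cJ i : c i \in J.
    by have [] := qform_jensen f_cvx Uu Vu Tu aJ bJ alpha01 Tc i.
  have [p pE] := sort_lambda_down >=%R fC.
  have [q qE] := sort_lambda_down >=%R PQ.
  apply: (prod_nth_expR_le kn (fun i => etrans (pE i) (lnf0 _ (cJ _))) qE).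
  apply: (sum_top_le (a := fun i => ln (f (c i)))) k1n.
    exact: (sum_le_convex_exp_product f_cvx Uu Vu Tu Wu aJ bJ alpha01 Tc
      _ _ EPE).
  move=> i j ij; rewrite -ler_expR -!qE.
  apply: (sort_nth_le (leR := >=%R)) => [u v|u v w uv wu|].
  + exact: ge_total.
  + exact: ge_trans uv wu.
  + by rewrite ij size_tuple ltn_ord.
- have cJ i : c i \in J.
    by have [] := qform_jensen f_ccv Uu Vu Tu aJ bJ alpha01 Tc i.
  have [p pE] := sort_lambda_down <=%R fC.
  have [q qE] := sort_lambda_down <=%R PQ.
  apply: (prod_nth_expR_le kn qE (fun i => etrans (pE i) (lnf0 _ (cJ _)))).
  (* Negation turns the k smallest [z] into the k largest values of -z, to which [sum_top_le]
     applies. *)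
  rewrite -lerN2 -!sumrN.
  apply: (sum_top_le (a := fun i => - ln (f (c i))) (z := fun i => - z i)) k1n.
    apply: (sum_le_convex_exp_product f_ccv Uu Vu Tu Wu aJ bJ alpha01 Tc _ _
      (exp_product_spectral_inv Uu Vu Wu EPE)) => i.
    * by rewrite mulrN.
    * by rewrite mulrN.
  move=> i j ij; rewrite lerN2 -ler_expR -!qE.
  apply: (sort_nth_le (leR := <=%R)) => [u v|u v w uv wu|].
  + exact: le_total.
  + exact: le_trans uv wu.
  + by rewrite ij size_tuple ltn_ord.
Qed.
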